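(* Fix an integer $m\ge 2$ and let $C_{2m+1}$ be the cycle graph on $2m+1$ vertices. Then: (1) every group $\mathrm{MH}_{k,l}(C_{2m+1})$ is torsion-free; (2) define $T:\mathbb Z\times\mathbb Z\to\mathbb Z$ by $T(k,l)=0$ if $k<0$ or $l<0$; $T(0,0)=2m+1$, $T(1,1)=4m+2$; and $T(k,l)=T(k-1,l-1)+2T(k-2,l-(m+1))$ for all other $(k,l)$ with $k,l\ge 0$. Then $\operatorname{rk}\mathrm{MH}_{k,l}(C_{2m+1})=T(k,l)$ for all integers $k,l$.
   Context: $d$ denotes the shortest-path distance. For vertices $x_0,\dots,x_k$ put $\ell(x_0,\dots,x_k)=\sum_{i=0}^{k-1}d(x_i,x_{i+1})$. The magnitude chain complex: $\mathrm{MC}_{k,l}(G)$ is the free abelian group on $I_{k,l}(G)=\{(x_0,\dots,x_k)\in V(G)^{k+1}: x_i\neq x_{i+1}\ \forall i,\ \ell(x_0,\dots,x_k)=l\}$, with differential $\partial=\sum_{i=1}^{k-1}(-1)^i\partial_i:\mathrm{MC}_{k,l}\to\mathrm{MC}_{k-1,l}$, where $\partial_i(x_0,\dots,x_k)=(x_0,\dots,\hat x_i,\dots,x_k)$ if deleting $x_i$ does not change $\ell$, and $0$ otherwise. Magnitude homology: $\mathrm{MH}_{k,l}(G)=H_k(\mathrm{MC}_{*,l}(G))$ (taken with $\mathbb Z$ coefficients); $\operatorname{rk}$ denotes rank of a finitely generated abelian group. *)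

(* Defs.v *)
From HB Require Import structures.
From mathcomp Require Import all_boot all_order all_algebra.
Set Implicit Arguments. Unset Strict Implicit. Unset Printing Implicit Defensive.
Import Order.TTheory GRing.Theory Num.Theory.

Fixpoint reach (T : finType) (e : rel T) (x : T) (k : nat) : {set T} :=
  match k with
  | 0 => [set x]
  | k'.+1 => reach e x k' :|: [set z | [exists y in reach e x k', e y z]]
  end.

(* shortest-path distance: least k with y reachable in <= k steps
   (equals #|T| if y is unreachable; irrelevant for connected graphs) *)
Definition gdist (T : finType) (e : rel T) (x y : T) : nat :=
  find (fun k => y \in reach e x k) (iota 0 #|T|).

Definition cycle_adj (n : nat) : rel 'I_n :=
  fun i j => (nat_of_ord j == i.+1 %% n) || (nat_of_ord i == j.+1 %% n).

Definition tlen (T : finType) (e : rel T) (k : nat) (x : k.+1.-tuple T) : nat :=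
  \sum_(i < k) gdist e (tnth x (widen_ord (leqnSn k) i)) (tnth x (lift ord0 i)).

Definition inI (T : finType) (e : rel T) (k l : nat) (x : k.+1.-tuple T) : bool :=
  [forall i : 'I_k, tnth x (widen_ord (leqnSn k) i) != tnth x (lift ord0 i)]
  && (tlen e x == l).

Definition del (T : finType) (k : nat) (x : k.+2.-tuple T) (i : 'I_k.+2)
  : k.+1.-tuple T := [tuple tnth x (lift i j) | j < k.+1].

(* Chains of MC_{k,l}: integer-valued functions on (k+1)-tuples supported on
   I_{k,l}; the chain group MC_{k,l} is the free abelian group on I_{k,l}. *)
Definition chain (T : finType) (e : rel T) (k l : nat)
  (c : {ffun k.+1.-tuple T -> int}) : Prop :=
  forall x, ~~ inI e l x -> c x = 0%R.

(* differential MC_{k+1,l} -> MC_{k,l}: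
   d(x_0..x_{k+1}) = sum_{i=1}^{k} (-1)^i d_i(x), extended linearly *)
Definition bd (T : finType) (e : rel T) (k l : nat)
  (c : {ffun k.+2.-tuple T -> int}) : {ffun k.+1.-tuple T -> int} :=
  [ffun y => (\sum_(x | inI e l x)
     \sum_(i : 'I_k.+2 | [&& (0 < (i : nat))%N, ((i : nat) < k.+1)%N, del x i == y
                            & tlen e (del x i) == tlen e x])
        ((-1) ^+ i * c x))%R].

Definition is_cycle (T : finType) (e : rel T) (l : nat) (k : nat)
  : {ffun k.+1.-tuple T -> int} -> Prop :=
  match k as k0 return {ffun k0.+1.-tuple T -> int} -> Prop with
  | 0 => fun c => chain e l c
  | k'.+1 => fun c => chain e l c /\ forall y, bd e l c y = 0%R
  end.

Definition is_bdry (T : finType) (e : rel T) (l : nat) (k : nat)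
  (c : {ffun k.+1.-tuple T -> int}) : Prop :=
  exists b : {ffun k.+2.-tuple T -> int}, chain e l b /\ forall y, bd e l b y = c y.

Definition MH_torsion_free (T : finType) (e : rel T) (k l : nat) : Prop :=
  forall c : {ffun k.+1.-tuple T -> int}, is_cycle e l c ->
  forall d : int, d != 0%R -> is_bdry e l [ffun x => (d * c x)%R] -> is_bdry e l c.

Definition MH_indep (T : finType) (e : rel T) (k l r : nat)
  (v : 'I_r -> {ffun k.+1.-tuple T -> int}) : Prop :=
  forall a : 'I_r -> int,
    is_bdry e l [ffun x => (\sum_(i < r) a i * v i x)%R] -> forall i, a i = 0%R.

Definition MH_rank (T : finType) (e : rel T) (k l r : nat) : Prop :=
  (exists v : 'I_r -> {ffun k.+1.-tuple T -> int},
      (forall i, is_cycle e l (v i)) /\ MH_indep e l v)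
  /\ (forall v : 'I_r.+1 -> {ffun k.+1.-tuple T -> int},
      (forall i, is_cycle e l (v i)) -> ~ MH_indep e l v).

Arguments cycle_adj n : clear implicits.

(* Main.v *)
(**
  Choosing shortest arcs turns a tuple of consecutively distinct vertices of the
  cycle into its first vertex and a word of signed steps +-1, ..., +-m. Deleting
  an interior vertex preserves the length exactly when the two adjacent steps
  have the same sign and sum to at most m, and then it adds them. The magnitude
  chain complex is thus 2m+1 copies of the reduced bar complex of
  Z[a, b] / (ab, a^(m+1), b^(m+1)).

  Splitting a first step of magnitude at least 2 into 1 followed by the rest is
  a homotopy that retracts this bar complex onto the words that are empty, start
  with (+-1, +-m), or start with +-1 followed by a step of the opposite sign or
  by nothing. In degrees at least 2 this retract is the sum of two copies of the
  complex shifted by (2, m+1) and one copy shifted by (1, 1), which is the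
  recursion for T. Iterating, each cycle is homologous to a combination of
  critical words, which are cycles themselves; products of the cocycles
  [s = +-1] and [s, t of the same sign with |s| + |t| = m+1] detect them.
*)
Require Import Defs.
From mathcomp Require Import all_boot all_order all_algebra.
From mathcomp Require Import zify.
Import Order.TTheory GRing.Theory Num.Theory.
Set Implicit Arguments. Unset Strict Implicit. Unset Printing Implicit Defensive.
Local Open Scope ring_scope.

(** * The complex of words *)

(* The letter (b, a) is a step of magnitude a + 1 in the direction b; it is valid
   for a < m. *)
Definition word := seq (bool * nat).

Definition weight (w : word) : nat := sumn [seq s.2.+1 | s <- w].

Definition valid (m : nat) (w : word) : bool := all (fun s => s.2 < m)%N w.

Definition hsign (w : word) : option bool := omap fst (ohead w).

(** For [n < m] these are the splittings of the letter [(b, n)] into two letters of its sign. For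
    [n = m] they are the pairs of total magnitude [m + 1], which do not merge and make up the
    2-cocycle in [phi]. *)
Definition splits (b : bool) (n : nat) (C : word -> int) (w : word) : int :=
  \sum_(a < n) C ((b, val a) :: (b, n.-1 - a)%N :: w).

(* Chains are coefficient functions, so the boundary of C at w collects the values of
   C at the words from which w arises by merging two letters. *)
Fixpoint wbd (C : word -> int) (w : word) : int :=
  if w is s :: w' then - splits s.1 s.2 C w' - wbd (fun u => C (s :: u)) w' else 0.

(* Cup product of the 1-cocycles [s = (b, 0)] and the 2-cocycles [s and t of sign b,
   total magnitude m + 1], one factor for each block of the critical word c. *)
Fixpoint phi (m : nat) (c : word) (C : word -> int) : int :=
  match c with
  | [::] => C [::]
  | s :: c1 =>
    match c1 with
    | [::] => C [:: (s.1, 0%N)]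
    | t :: c2 => if s.1 == t.1 then phi m c2 (splits s.1 m C)
                 else phi m c1 (fun w => C ((s.1, 0%N) :: w))
    end
  end.

(* Concatenations of blocks (b, 0)(b, m-1) and (b, 0), where a block (b, 0) is last or
   is followed by a letter of the opposite sign. *)
Fixpoint critical (m : nat) (c : word) : bool :=
  match c with
  | [::] => true
  | s :: c1 =>
    (s.2 == 0%N) &&
    match c1 with
    | [::] => true
    | t :: c2 => if s.1 == t.1 then (t.2 == m.-1) && critical m c2
                 else critical m c1
    end
  end.

(** [phi] and [critical] drop one or two letters at a time, so both tails are needed. *)
Lemma word_ind (P : word -> Prop) :
  P [::] -> (forall s, P [:: s]) ->
  (forall s t c, P c -> P (t :: c) -> P [:: s, t & c]) -> forall c, P c.
Proof.
move=> P0 P1 P2 c; suff [] : P c /\ forall s, P (s :: c) by [].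
by elim: c => [|t c [IH1 IH2]]; split=> // s; apply: P2.
Qed.

(** Splitting a letter keeps the weight, the first sign and validity. Hence [C] may be replaced by a
    function that agrees with it only for one weight or one first sign. *)
Lemma wbd_local (m : nat) (C C' : word -> int) (w : word) :
  (forall u, size u = (size w).+1 -> weight u = weight w ->
     (valid m w -> valid m u) -> hsign u = hsign w -> C u = C' u) ->
  wbd C w = wbd C' w.
Proof.
elim: w C C' => [|[b s] w IH] C C' H //=.
congr (- _ - _).
  apply: eq_bigr => a _; have := ltn_ord a => la; apply: H => //=.
  - by rewrite /weight /=; lia.
  - by move=> /andP[h ->]; rewrite andbT; apply/andP; split; lia.
apply: IH => u hs hw hv hh; apply: H; rewrite /= ?hs //.
- by rewrite /weight /= in hw *; lia.
- by move=> /andP[-> /hv].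
Qed.

Lemma phi_local (m : nat) (C C' : word -> int) (c : word) : critical m c ->
  (forall u, size u = size c -> weight u = weight c ->
     valid m u -> hsign u = hsign c -> C u = C' u) ->
  (0 < m)%N -> phi m c C = phi m c C'.
Proof.
move=> + + m0.
elim/word_ind: c C C' => [|[b a]|[b a] [b' a'] c IH1 IH2] C C' /=.
- by move=> _; apply.
- by rewrite andbT => /eqP -> H; apply: H => //=; rewrite m0.
case: (b =P b') => [<-|ne]; rewrite /=.
  move=> /and3P[/eqP -> /eqP -> cr] H; apply: IH1 => // u hs hw hv hh.
  apply: eq_bigr => i _; have := ltn_ord i => li; apply: H => //=.
  - by rewrite hs.
  - by rewrite /weight /= in hw *; lia.
  - by rewrite hv andbT; apply/andP; split; lia.
move=> /andP[/eqP -> cr] H; apply: IH2 => // u hs hw hv hh.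
apply: H => //=; rewrite ?hs ?m0 //.
by rewrite /weight /= in hw *; lia.
Qed.

Lemma eq_wbd (C C' : word -> int) (w : word) : C =1 C' -> wbd C w = wbd C' w.
Proof. by move=> H; apply: (wbd_local (m := 0)). Qed.

Lemma eq_phi (m : nat) (c : word) (C C' : word -> int) :
  C =1 C' -> phi m c C = phi m c C'.
Proof.
elim/word_ind: c C C' => [|s|s t c IH1 IH2] C C' H //=.
case: eqP => _; last by apply: IH2 => u.
by apply: IH1 => u; apply: eq_bigr.
Qed.

Lemma wbd_sum (r : nat) (a : 'I_r -> int) (C : 'I_r -> word -> int) (w : word) :
  wbd (fun u => \sum_i a i * C i u) w = \sum_i a i * wbd (C i) w.
Proof.
elim: w C => [|s w IH] C /=; first by rewrite big1 // => i _; rewrite mulr0.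
rewrite (IH (fun i u => C i (s :: u))) /splits exchange_big /= -!sumrN -big_split /=.
by apply: eq_bigr => i _; rewrite -mulr_sumr mulrBr mulrN.
Qed.

Lemma phi_sum (m r : nat) (a : 'I_r -> int) (C : 'I_r -> word -> int) (c : word) :
  phi m c (fun u => \sum_i a i * C i u) = \sum_i a i * phi m c (C i).
Proof.
elim/word_ind: c C => [|s|s t c IH1 IH2] C //=.
case: eqP => _; last exact: (IH2 (fun i u => C i ((s.1, 0%N) :: u))).
rewrite -IH1; apply: eq_phi => u; rewrite /splits exchange_big /=.
by apply: eq_bigr => i _; rewrite mulr_sumr.
Qed.

Lemma wbd0 (w : word) : wbd (fun=> 0) w = 0.
Proof.
by elim: w => [|s w IH] //=; rewrite IH /splits big1 // subr0 oppr0.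
Qed.

Lemma wbdN (C : word -> int) (w : word) : wbd (fun u => - C u) w = - wbd C w.
Proof.
elim: w C => [|s w IH] C /=; first by rewrite oppr0.
by rewrite (IH (fun u => C (s :: u))) /splits sumrN opprD.
Qed.

Lemma phi0 (m : nat) (c : word) : phi m c (fun=> 0) = 0.
Proof.
elim/word_ind: c => //= s t c IH1 IH2; case: eqP => _ //.
by rewrite -[RHS]IH1; apply: eq_phi => u; rewrite /splits big1.
Qed.

(** Both sides run over the compositions of [n + 1] into three positive parts: the left one refines
    the first part of a two-part composition, the right one the second. *)
Lemma sum_compositions3 (n : nat) (F : nat -> nat -> nat -> int) :
  \sum_(a < n) \sum_(i < a) F i (a.-1 - i)%N (n.-1 - a)%N =
  \sum_(a < n) \sum_(j < n.-1 - a) F a j ((n.-1 - a).-1 - j)%N.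
Proof.
pose G a i := F i (a.-1 - i)%N (n.-1 - a)%N.
have -> : \sum_(a < n) \sum_(i < a) F i (a.-1 - i)%N (n.-1 - a)%N
        = \sum_(0 <= a < n) \sum_(0 <= i < n | (i < a)%N) G a i.
  rewrite big_mkord; apply: eq_bigr => a _.
  by rewrite big_mkord -(big_ord_widen n (G a)) // ltnW.
rewrite (exchange_big_dep_nat xpredT) //= -(big_mkord xpredT
  (fun a => \sum_(j < n.-1 - a) F a j ((n.-1 - a).-1 - j)%N)).
apply: eq_big_nat => i /andP[_ lin].
rewrite (big_cat_nat (n := i.+1)) //= [X in X + _]big1_seq ?add0r; last first.
  by move=> a; rewrite mem_index_iota; lia.
rewrite -{1}[i.+1]add0n big_addn big_mkcond /=.
rewrite -(big_mkord xpredT (fun j => F i j ((n.-1 - i).-1 - j)%N)).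
have -> : (n - i.+1 = n.-1 - i)%N by lia.
apply: eq_big_nat => j lj; rewrite /G ifT; last lia.
by congr F; lia.
Qed.

(** Splitting the first or the second half of a pair gives the same triples with opposite signs.
    Only the splittings inside [w] remain, with sign +1 after passing two letters. *)
Lemma splits_wbd (b : bool) (n : nat) (C : word -> int) (w : word) :
  splits b n (wbd C) w = wbd (splits b n C) w.
Proof.
pose D (a : 'I_n) u := C ((b, val a) :: (b, n.-1 - a)%N :: u).
have -> : wbd (splits b n C) w = \sum_(a < n) wbd (D a) w.
  transitivity (wbd (fun u => \sum_(a < n) 1 * D a u) w).
    by apply: eq_wbd => u; apply: eq_bigr => a _; rewrite mul1r.
  by rewrite wbd_sum; apply: eq_bigr => a _; rewrite mul1r.
rewrite /splits /=.
under eq_bigr => a _ do rewrite opprB addrA opprK.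
rewrite !big_split /= sumrN addrAC.
rewrite [X in - X](sum_compositions3 n (fun i j l => C [:: (b, i), (b, j), (b, l) & w])).
by rewrite addNr add0r.
Qed.

Lemma wbd_cons (C : word -> int) (s : bool * nat) (w : word) :
  wbd C (s :: w) = - splits s.1 s.2 C w - wbd (fun u => C (s :: u)) w.
Proof. by []. Qed.

Lemma splits0 (b : bool) (C : word -> int) (w : word) : splits b 0 C w = 0.
Proof. by rewrite /splits big_ord0. Qed.

Lemma phi_cons2 (m : nat) (s t : bool * nat) (c : word) (C : word -> int) :
  phi m [:: s, t & c] C =
  if s.1 == t.1 then phi m c (splits s.1 m C)
  else phi m (t :: c) (fun w => C ((s.1, 0%N) :: w)).
Proof. by []. Qed.

(** Each factor is a cocycle: a letter of magnitude 1 has no splitting, and [splits_wbd] treats the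
    pairs of total magnitude [m + 1]. *)
Lemma phi_wbd (m : nat) (C : word -> int) (c : word) : phi m c (wbd C) = 0.
Proof.
elim/word_ind: c C => [|s|s t c IH1 IH2] C //.
  by rewrite /= /splits big_ord0 subr0 oppr0.
rewrite phi_cons2; case: eqP => _.
  by rewrite -[RHS](IH1 (splits s.1 m C)); apply: eq_phi => w; rewrite splits_wbd.
rewrite -[RHS](IH2 (fun w => - C ((s.1, 0%N) :: w))); apply: eq_phi => w /=.
by rewrite wbdN /splits big_ord0 oppr0 add0r.
Qed.

(** Strong induction on the degree: the components of [C] on the shifted summands of the retract
    inherit both hypotheses, and their primitives [F] and [G] combine with the homotopy into [B]. *)
Lemma wbd_exact (m k : nat) (C : word -> int) : (0 < m)%N ->
  (forall w, valid m w -> (size w).+1 = k -> wbd C w = 0) ->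
  (forall c, critical m c -> size c = k -> phi m c C = 0) ->
  exists B, forall w, valid m w -> size w = k -> wbd B w = C w.
Proof.
move=> m0; elim/ltn_ind: k C => k IH C cycC phiC.
case: k => [|k] in IH cycC phiC *.
  exists (fun=> 0) => -[|//] _ _; rewrite wbd0.
  by have := phiC [::] isT erefl.
(* The component on words whose first letter has magnitude 1 and is followed by the opposite sign.
   The second letter determines the first, so one function covers both signs. *)
pose E (w : word) := if w is s :: _ then C ((~~ s.1, 0%N) :: w) else 0.
(* The empty word is exempt: [phi] detects the one-letter words [(b, 0)] directly. *)
have [F FP] : exists F, forall w, valid m w -> size w = k -> wbd F w = if w is [::] then 0 else E w.
  case: k => [|k] in IH cycC phiC *.
    by exists (fun=> 0) => -[|//].
  suff [F FP] : exists F, forall w, valid m w -> size w = k.+1 -> wbd F w = E w.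
    by exists F => -[|s w] // vw sw; rewrite FP.
  apply: IH => // [[|s w] vw sw|[|s c] crc sc] //.
    rewrite (@wbd_local m _ (fun u => C ((~~ s.1, 0%N) :: u))); last first.
      by move=> [|t u] //= _ _ _ [->].
    have := cycC ((~~ s.1, 0%N) :: s :: w); rewrite /= m0 -/(valid m _) => /(_ vw).
    by rewrite sw -wbd_cons => /(_ erefl) /eqP; rewrite splits0 oppr0 sub0r oppr_eq0 => /eqP.
  rewrite (@phi_local m _ (fun u => C ((~~ s.1, 0%N) :: u))) //; last first.
    by move=> [|t u] //= _ _ _ [->].
  rewrite -(phiC ((~~ s.1, 0%N) :: s :: c)) /=; first by case: s.1.
    by move: crc => /=; case: s.1.
  by move: sc => /= ->.
(* The sum over all pairs of total magnitude [m + 1] replaces the single value at [(b, 0)(b, m-1)]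
   because it commutes with [wbd]. *)
have [G GP] : exists G : bool -> word -> int, forall b w, valid m w -> (size w).+1 = k ->
    wbd (G b) w = splits b m C w.
  case: k => [|k] in IH cycC phiC FP *; first by exists (fun _ _ => 0).
  have ex b : exists B, forall w, valid m w -> size w = k -> wbd B w = splits b m C w.
    apply: IH => // [w vw sw|c crc sc].
      rewrite -splits_wbd /splits big1 // => a _; apply: cycC => /=; last by rewrite sw.
      by rewrite vw andbT; have := ltn_ord a; lia.
    rewrite -(phiC [:: (b, 0%N), (b, m.-1) & c]) /= ?sc ?eqxx //.
  have [Gt GtP] := ex true; have [Gf GfP] := ex false.
  exists (fun b => if b then Gt else Gf) => -[] w vw [sw]; first exact: GtP.
  exact: GfP.
(* The first value is the contracting homotopy of the retraction; the others solve the
   problem on its summands. *)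
pose B (w : word) : int :=
  if w is [:: (b, 0%N), (b', t) & w'] then
    if b == b' then
      if (t.+1 < m)%N then - C ((b, t.+1) :: w') else G b w'
    else - F ((b', t) :: w')
  else 0.
exists B => -[|[b [|s]] [|[b' t] w]] // vw [sw]; rewrite wbd_cons ?splits0.
- by have /= -> := phiC [:: (b, 0%N)] isT (congr1 succn sw); rewrite subr0 oppr0.
- rewrite oppr0 sub0r.
  have [eb|ne] := eqVneq b b'; last first.
    have eb : b = ~~ b' by case: b b' ne {vw} => [] [].
    transitivity (E ((b', t) :: w)); last by rewrite /E /= -eb.
    have vw' : valid m ((b', t) :: w) by case/andP: vw.
    rewrite -[RHS](FP _ vw' sw) -wbdN; apply: (@wbd_local m) => -[|[b1 t1] u] //= _ _ _ [->].
    by rewrite (negbTE ne) opprK.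
  rewrite wbd_cons -eb /= in vw *; rewrite opprB opprK.
  have lt : (t < m)%N by case/and3P: vw.
  have vw' : valid m w by case/and3P: vw.
  (* For [t + 1 < m] this is the cycle condition at [(b, t+1) :: w]; for [t + 1 = m] it is the
     choice of [G]. *)
  have -> : wbd (fun u => B [:: (b, 0%N), (b, t) & u]) w = splits b t.+1 C w.
    rewrite /B /= eqxx; have [lt1|] := boolP (t.+1 < m)%N.
      have := cycC ((b, t.+1) :: w); rewrite wbd_cons /= lt1 vw' -sw => /(_ isT erefl) /eqP.
      by rewrite wbdN subr_eq0 => /eqP <-; rewrite opprK.
    by rewrite -leqNgt => le; have <- : m = t.+1; [lia | apply: GP].
  (* The term with first part 1 is the wanted value; the others cancel against the splittings of
     [(b, t)]. *)
  rewrite /splits big_ord_recl /= subn0 -addrA -[RHS]addr0; congr (_ + _).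
  apply/eqP; rewrite addrC -big_split /= big1 // => i _; have := ltn_ord i => li.
  rewrite eqxx ifT; last lia.
  have -> : (t - bump 0 i = t.-1 - i)%N by rewrite /bump; lia.
  by rewrite addNr.
(* When the first letter has magnitude at least 2, only its splitting with first part 1 meets the
   support of [B]. *)
- rewrite wbd0 /splits big_ord_recl big1 // subr0 addr0 /= subn0 eqxx ifT ?opprK //.
  by case/andP: vw.
- rewrite wbd0 /splits big_ord_recl big1 // subr0 addr0 /= subn0 eqxx ifT ?opprK //.
  by case/andP: vw.
Qed.

(** * Critical words *)

Lemma critical_cons2 (m : nat) (s t : bool * nat) (c : word) :
  critical m [:: s, t & c] =
  (s.2 == 0%N) && if s.1 == t.1 then (t.2 == m.-1) && critical m c
                  else critical m (t :: c).
Proof. by []. Qed.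

(** [phi m c] evaluates at the words obtained from [c] by replacing blocks [(b, 0)(b, m-1)] with
    pairs [(b, a)(b, m-1-a)]. Only [a = 0] keeps such a word critical. *)
Lemma phi_delta (m : nat) (c c' : word) : (0 < m)%N ->
  critical m c -> critical m c' -> phi m c (fun w => (w == c')%:R) = (c == c')%:R.
Proof.
have Z d C : C =1 (fun=> 0) -> phi m d C = 0.
  by move=> C0; rewrite (eq_phi m d C0) phi0.
move=> m0; elim/word_ind: c c' => [|[b a]|[b a] [b' a'] c IH1 IH2] c' //.
  by rewrite /= andbT => /eqP ->.
rewrite critical_cons2 phi_cons2 [(b, a).2 == _]/= => /andP[/eqP -> {a}].
rewrite -![(b, _).1]/b -![(b', a').1]/b' -![(b', a').2]/a'.
case: (b =P b') => [<-|/eqP ne].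
  move=> /andP[/eqP -> crc] crc'.
  transitivity (phi m c (fun w => ([:: (b, 0%N), (b, m.-1) & w] == c')%:R)).
    apply: eq_phi => w; rewrite /splits (bigD1 (Ordinal m0)) //= subn0 big1 ?addr0 // => i ni.
    case: eqP => // ec; move: crc'; rewrite -ec /= => /andP[/eqP i0 _].
    by case/eqP: ni; apply/val_inj.
  case: c' crc' => [|s' [|t' c']]; try by rewrite Z.
    by move=> _; rewrite eqseq_cons andbF Z // => w; rewrite eqseq_cons andbF.
  rewrite critical_cons2 => crc'.
  have [e1|ne1] := eqVneq (b, 0%N) s'; last first.
    by rewrite eqseq_cons (negbTE ne1) Z // => w; rewrite eqseq_cons (negbTE ne1).
  have [e2|ne2] := eqVneq (b, m.-1) t'; last first.
    rewrite !eqseq_cons (negbTE ne2) andbF Z // => w.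
    by rewrite !eqseq_cons (negbTE ne2) andbF.
  rewrite -e1 -e2 /= eqxx in crc' *; case/andP: crc' => _ crc'.
  rewrite !eqseq_cons !eqxx /= -IH1 //; apply: eq_phi => w.
  by rewrite !eqseq_cons !eqxx.
move=> crc; case: c' => [|s' c'] crc'; first by rewrite Z.
have [e1|ne1] := eqVneq (b, 0%N) s'; last first.
  by rewrite eqseq_cons (negbTE ne1) Z // => w; rewrite eqseq_cons (negbTE ne1).
rewrite -e1 eqseq_cons eqxx andTb.
transitivity (phi m ((b', a') :: c) (fun w => (w == c')%:R)).
  by apply: eq_phi => w; rewrite eqseq_cons eqxx.
case: c' crc' => [|t' c' crc']; first by move=> _; apply: IH2.
have [e2|ne2] := eqVneq b t'.1; last first.
  by apply: IH2 => //; move: crc'; rewrite critical_cons2 -e1 /= (negbTE ne2).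
(* Here [c'] opens with a two-letter block, so its tail need not be critical; but [phi] at
   [(b', a') :: c] only sees words of first sign [b']. *)
have ne' : (b', a') != t' by apply: contra ne => /eqP et; rewrite e2 -et.
rewrite eqseq_cons (negbTE ne') -[RHS](phi0 m ((b', a') :: c)).
apply: (@phi_local m) => // -[|s u] //= _ _ _ [es].
rewrite eqseq_cons; case: eqP => // e; move: ne; by rewrite e2 -e es eqxx.
Qed.

(* Restores a leading block (b, 0), whose sign is forced by the next letter. *)
Definition alternate (c : word) : word :=
  if c is s :: _ then (~~ s.1, 0%N) :: c else c.

(** Sorted by first block, in parallel with the recursion for T. A one-letter block has no free sign
    unless it is last, which is why length 1 is separate. The guards on [l] match the vanishing of T
    at negative arguments. *)
Fixpoint crits (m k l : nat) : seq word :=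
  match k with
  | 0 => if l == 0%N then [:: [::]] else [::]
  | k1.+1 =>
    match k1 with
    | 0 => if l == 1%N then [:: [:: (true, 0%N)]; [:: (false, 0%N)]] else [::]
    | k2.+1 =>
      (if l is l1.+1 then [seq alternate c | c <- crits m k1 l1] else [::]) ++
      (if (m < l)%N then [seq [:: (b, 0%N), (b, m.-1) & c] | b <- [:: true; false],
                                                     c <- crits m k2 (l - m.+1)]
       else [::])
    end
  end.

Lemma crits_SS (m k l : nat) :
  crits m k.+2 l =
    (if l is l1.+1 then [seq alternate c | c <- crits m k.+1 l1] else [::]) ++
    (if (m < l)%N then [seq [:: (b, 0%N), (b, m.-1) & c] | b <- [:: true; false],
                                                   c <- crits m k (l - m.+1)]
     else [::]).
Proof. by []. Qed.

Lemma weight_cons (s : bool * nat) (w : word) : weight (s :: w) = (s.2.+1 + weight w)%N.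
Proof. by []. Qed.

Lemma mem_crits (m k l : nat) (c : word) : (0 < m)%N ->
  (c \in crits m k l) = [&& critical m c, size c == k & weight c == l].
Proof.
move=> m0; elim/ltn_ind: k l c => -[|[|k]] IH l c.
- by rewrite /=; case: l => [|l]; case: c => [|s c] //=; rewrite ?in_nil ?andbF.
- case: c => [|[b a] [|t c]]; rewrite /= ?andbF; try by case: (l == 1%N).
    rewrite /weight /= addn0 andbT; case: (l =P 1%N) => [->|nl].
      by rewrite !inE !eqseq_cons !xpair_eqE eqSS andbb !andbT; case: (b); rewrite ?orbF.
    by apply/esym/negbTE; lia.
  by case: (l == 1%N) => //; rewrite !inE !eqseq_cons !andbF.
rewrite crits_SS mem_cat; apply/orP/idP => [[]|].
- case: l => // l /mapP[d]; rewrite IH // => /and3P[crd /eqP sd /eqP wd] ->.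
  case: d crd sd wd => [|s d] // crd sd wd.
  have ns : (~~ s.1 == s.1) = false by case: s.1.
  rewrite [alternate _]/= critical_cons2 ns crd weight_cons wd.
  by apply/andP; split=> //; apply/andP; split=> //; move: sd => /= ->.
- case: ifP => // lm /allpairsP[[b d] /= [_]];
  rewrite (IH k (leqnSn _)) => /and3P[crd /eqP sd /eqP wd] ->.
  rewrite critical_cons2 !eqxx crd.
  rewrite !weight_cons wd.
  rewrite [size _]/= sd.
  rewrite eqxx.
  rewrite [(_, _).2]/=.
  have -> : (1 + (m.-1.+1 + (l - m.+1)) = l)%N.
    by clear -m0 lm; lia.
  by rewrite eqxx.
case: c => [|s [|t c]] //; rewrite ?andbF // critical_cons2.
rewrite !weight_cons => /and3P[/andP[/eqP s0]] + + /eqP.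
case: s s0 => b a; rewrite -![(b, a).1]/b -![(b, a).2]/a => -> {a}.
case: (b =P t.1) => [eb|/eqP ne].
  move=> /andP[/eqP t0 crc] sc wc; right; rewrite t0 /= in wc.
  rewrite ifT; last lia.
  apply/allpairsP; exists (b, c); split => /=; first by case: (b).
    rewrite (IH k (leqnSn _)) crc andTb; apply/andP; split; first exact: sc.
    by apply/eqP; clear -wc m0; lia.
  by case: t eb t0 {sc wc} => b' a /= <- ->.
move=> crc sc; case: l => [|l] wc; first by move: wc; rewrite /=; clear; lia.
left; apply/mapP; exists (t :: c); last first.
  by congr ((_, _) :: _); clear -ne; case: b ne; case: t.1.
rewrite IH // crc andTb; apply/andP; split; first exact: sc.
by apply/eqP; rewrite weight_cons; move: wc; clear; lia.
Qed.

Lemma uniq_crits (m k l : nat) : uniq (crits m k l).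
Proof.
elim/ltn_ind: k l => -[|[|k]] IH l; try by rewrite /=; case: ifP.
rewrite crits_SS cat_uniq; apply/and3P; split.
- case: l => // l; rewrite map_inj_uniq ?IH // => -[|s c] [|s' c'] //= [].
  by move=> _ -> ->.
- apply/hasPn => c; case: ifP => // _ /allpairsP[[b d] /= [_ _ ->]].
  case: l => // l; apply/mapP => -[[|s e]] //= _ [eb es _].
  by move: eb; rewrite -es; clear; case: b.
- case: ifP => // _; apply: allpairs_uniq => //; first exact: (IH k (leqnSn _)).
  by move=> [b c] [b' c'] _ _ /= [-> _ ->].
Qed.

Lemma size_crits (m k l : nat) :
  size (crits m k.+2 l) =
    ((if l is l1.+1 then size (crits m k.+1 l1) else 0) +
     (if m < l then 2 * size (crits m k (l - m.+1)) else 0))%N.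
Proof.
rewrite crits_SS size_cat; congr (_ + _)%N; first by case: l => // l; rewrite size_map.
by case: ifP => // _; rewrite size_allpairs.
Qed.

(** The factor [2 * m + 1] counts the starting vertices. *)
Lemma rank_recursion (m : nat) (T : int -> int -> int)
  (HTneg : forall k l : int, (k < 0) || (l < 0) -> T k l = 0)
  (HT00 : T 0 0 = (2 * m + 1)%N%:Z)
  (HT11 : T 1 1 = (4 * m + 2)%N%:Z)
  (HTrec : forall k l : int, 0 <= k -> 0 <= l -> (k, l) != (0, 0) -> (k, l) != (1, 1) ->
     T k l = T (k - 1) (l - 1) + 2 * T (k - 2) (l - (m.+1)%:Z)) (k l : nat) :
  T k%:Z l%:Z = ((2 * m + 1) * size (crits m k l))%N%:Z.
Proof.
have T0 (j : nat) : T 0 j.+1 = 0.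
  by rewrite HTrec // !HTneg // mulr0.
have T1 (j : nat) : j != 1%N -> T 1 j = 0.
  case: j => [|[|j]] // _; rewrite HTrec // [T (1 - 2) _]HTneg // mulr0 addr0.
    by rewrite HTneg.
  have -> : j.+2%:Z - 1 = j.+1%:Z by lia.
  by rewrite subrr T0.
elim/ltn_ind: k l => -[|[|k]] IH l.
- by case: l => [|l] /=; rewrite ?HT00 ?T0 ?muln1 ?muln0.
- rewrite /=; case: eqP => [->|/eqP/T1 ->]; last by rewrite muln0.
  by rewrite HT11; congr Posz; rewrite /=; lia.
rewrite HTrec // size_crits mulnDr PoszD; congr (_ + _).
  case: l => [|l]; first by rewrite HTneg ?muln0.
  by rewrite -IH //; congr (T _ _); lia.
have -> : k.+2%:Z - 2 = k%:Z by rewrite -[k.+2]addn2 PoszD addrK.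
case: ifP => lm; last first.
  by rewrite [T _ _]HTneg ?mulr0 ?muln0 //; lia.
have -> : l%:Z - m.+1%:Z = (l - m.+1)%N%:Z by lia.
by rewrite (IH k (leqnSn _)) mulnCA PoszM.
Qed.

(** * Distances in the cycle *)

Definition cdist (n : nat) (x y : nat) : nat :=
  let d := (if x <= y then y - x else x - y)%N in minn d (n - d).

(** Without the modulus, the case analyses below are linear arithmetic. *)
Lemma cycle_adjE (n : nat) (x y : 'I_n) :
  cycle_adj n x y = [|| y == x.+1 :> nat, x == y.+1 :> nat,
    (y == 0 :> nat) && (x.+1 == n) | (x == 0 :> nat) && (y.+1 == n)]%N.
Proof.
have modS (z : 'I_n) : (z.+1 %% n = if z.+1 == n then 0 else z.+1)%N.
  case: eqP => [->|ne]; first by rewrite modnn.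
  by rewrite modn_small //; have := ltn_ord z; lia.
have := ltn_ord x; have := ltn_ord y.
by rewrite /cycle_adj !modS; do 2 case: ifP; lia.
Qed.

Lemma mem_reach_cycle (n : nat) (x y : 'I_n) (k : nat) :
  (y \in reach (cycle_adj n) x k) = (cdist n x y <= k)%N.
Proof.
have ltx := ltn_ord x.
elim: k y => [|k IH] y; have lty := ltn_ord y.
  by rewrite /= inE -val_eqE /= /cdist; case: ifP; lia.
rewrite /= !inE IH; apply/orP/idP => [[|/existsP[z /andP[]]]|le].
- lia.
- have ltz := ltn_ord z.
  rewrite IH cycle_adjE /cdist; case: ifP; case: ifP; lia.
have [lek|gtk] := leqP (cdist n x y) k; first by left.
have ek : cdist n x y = k.+1 by lia.
have nb (z : nat) (ltz : (z < n)%N) : (cdist n x z <= k)%N ->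
    cycle_adj n (Ordinal ltz) y -> [exists y0 in reach (cycle_adj n) x k, cycle_adj n y0 y].
  by move=> h1 h2; apply/existsP; exists (Ordinal ltz); rewrite IH h1.
right.
(* One of the two cyclic neighbours of [y] is nearer to [x]. *)
pose yp := (if y.+1 == n then 0 else y.+1)%N.
pose ym := (if y == 0 :> nat then n.-1 else y.-1)%N.
have ltp : (yp < n)%N by rewrite /yp; case: ifP; lia.
have ltm : (ym < n)%N by rewrite /ym; case: ifP; lia.
have [h|h] := leqP (cdist n x yp) k.
  by apply: (nb _ ltp h); rewrite cycle_adjE /= /yp; case: ifP; lia.
apply: (nb _ ltm); last by rewrite cycle_adjE /= /ym; case: ifP; lia.
by move: ek h; rewrite /cdist /yp /ym; do 5 (case: ifP); lia.
Qed.

Lemma find_leq_iota (d n : nat) : (d < n)%N -> find (leq d) (iota 0 n) = d.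
Proof.
move=> lt; rewrite -(subnKC (ltnW lt)) iotaD find_cat size_iota add0n.
have /negbTE -> : ~~ has (leq d) (iota 0 d).
  by apply/hasPn => k; rewrite mem_iota; lia.
by rewrite -[(n - _)%N]prednK ?subn_gt0 //= leqnn addn0.
Qed.

Lemma gdist_cycle (n : nat) (x y : 'I_n) : gdist (cycle_adj n) x y = cdist n x y.
Proof.
rewrite /gdist card_ord (eq_find (mem_reach_cycle x y)) find_leq_iota //.
by have := ltn_ord x; have := ltn_ord y; rewrite /cdist; case: ifP; lia.
Qed.

Definition moven (m x : nat) (s : bool * nat) : nat :=
  (if s.1 then if x + s.2.+1 < 2 * m + 1 then x + s.2.+1 else x + s.2.+1 - (2 * m + 1)
   else if s.2 < x then x - s.2.+1 else x + (2 * m + 1) - s.2.+1)%N.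

(** The default of [insubd] is never reached for a valid letter, by [val_move]. *)
Definition move (m : nat) (x : 'I_(2 * m + 1)) (s : bool * nat) : 'I_(2 * m + 1) :=
  insubd x (moven m x s).

(** The residue [d] of [y - x] and its complement [2m + 1 - d] differ, the cycle being odd, so the
    shorter arc is unique. A letter stores its magnitude minus 1. *)
Definition step (m : nat) (x y : 'I_(2 * m + 1)) : bool * nat :=
  (let d := if x <= y then y - x else y + (2 * m + 1) - x in
   if d <= m then (true, d.-1) else (false, (2 * m - d)))%N.

Lemma val_move (m : nat) (x : 'I_(2 * m + 1)) (s : bool * nat) :
  (s.2 < m)%N -> move x s = moven m x s :> nat.
Proof.
move=> lt; rewrite /move val_insubd ifT //; have := ltn_ord x.
by rewrite /moven; do 3 (try case: ifP); lia.
Qed.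

Lemma move_step (m : nat) (x y : 'I_(2 * m + 1)) : x != y ->
  ((step x y).2 < m)%N /\ move x (step x y) = y.
Proof.
rewrite -val_eqE /= => ne; have ltx := ltn_ord x; have lty := ltn_ord y.
have lt : ((step x y).2 < m)%N.
  by rewrite /step; case: (leqP x y); case: ifP => /=; lia.
split=> //; apply: val_inj => /=; rewrite val_move //; move: lt.
rewrite /step; case: (leqP x y) => h1; case: ifP => /= h2; rewrite /moven /=; case: ifP; lia.
Qed.

Lemma step_move (m : nat) (x : 'I_(2 * m + 1)) (s : bool * nat) : (s.2 < m)%N ->
  step x (move x s) = s.
Proof.
move=> lt; have ltx := ltn_ord x; case: s lt => b a /= lt.
rewrite /step val_move // /moven /=.
case: b; set y := (X in (x <= X)%N).
  have -> : (if x <= y then y - x else y + (2 * m + 1) - x)%N = a.+1.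
    by rewrite /y; do 2 (case: ifP); lia.
  by rewrite lt.
have -> : (if x <= y then y - x else y + (2 * m + 1) - x)%N = (2 * m - a)%N.
  by rewrite /y; do 2 (case: ifP); lia.
by rewrite ifF; [congr (_, _); lia | lia].
Qed.

Lemma move_neq (m : nat) (x : 'I_(2 * m + 1)) (s : bool * nat) : (s.2 < m)%N ->
  x != move x s.
Proof.
move=> lt; rewrite -val_eqE /= val_move //; have ltx := ltn_ord x.
by rewrite /moven; case: s.1; case: ifP; lia.
Qed.

Lemma gdist_move (m : nat) (x : 'I_(2 * m + 1)) (s : bool * nat) : (s.2 < m)%N ->
  gdist (cycle_adj (2 * m + 1)) x (move x s) = s.2.+1.
Proof.
move=> lt; rewrite gdist_cycle val_move // /moven /cdist; have ltx := ltn_ord x.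
by case: s.1; case: ifP; case: ifP; lia.
Qed.

Lemma move_move (m : nat) (x : 'I_(2 * m + 1)) (b : bool) (a c : nat) :
  (a < c < m)%N -> move (move x (b, a)) (b, c.-1 - a)%N = move x (b, c).
Proof.
move=> /andP[lac lcm]; have ltx := ltn_ord x; apply: val_inj => /=.
rewrite !val_move /=; try lia.
by rewrite /moven /=; case: b; do 3 (case: ifP); lia.
Qed.

Definition between (T : finType) (e : rel T) (x v y : T) : bool :=
  [&& x != v, v != y & gdist e x v + gdist e v y == gdist e x y]%N.

(** The vertices between the ends of a step are the inner vertices of its arc: this turns insertion
    of a vertex into splitting of a letter. *)
Lemma sum_between (m : nat) (x : 'I_(2 * m + 1)) (s : bool * nat) (F : 'I_(2 * m + 1) -> int) :
  (s.2 < m)%N ->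
  \sum_(v | between (cycle_adj (2 * m + 1)) x v (move x s)) F v =
  \sum_(a < s.2) F (move x (s.1, val a)).
Proof.
case: s => b s /= lt.
pose r := [seq move x (b, a) | a <- iota 0 s].
have ur : uniq r.
  rewrite map_inj_in_uniq ?iota_uniq // => a a'; rewrite !mem_iota => la la' e.
  have : (b, a) = (b, a') by rewrite -(@step_move m x (b, a)) ?e ?step_move //=; lia.
  by case.
transitivity (\sum_(v <- r) F v); last by rewrite big_map -[s in iota 0 s]subn0 big_mkord.
rewrite [RHS]big_uniq //; apply: eq_bigl => v; apply/idP/mapP.
  move=> /and3P[xv + /eqP]; have [lv <-] := move_step xv.
  rewrite !gdist_move //; case: (step x v) lv {xv} => b' a /= la.
  rewrite -val_eqE /= gdist_cycle /cdist !val_move //= => vy dy.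
  have ltx := ltn_ord x.
  have := ltn_ord (move x (b', a)); have := ltn_ord (move x (b, s)); rewrite !val_move // => l2 l1.
  have las : (a < s)%N by move: vy dy l1 l2; clear; case: ifP; lia.
  exists a; first by rewrite mem_iota.
  (* In the opposite direction the distance from [v] to the endpoint would be [a + s + 2] or
     [2m - 1 - a - s]. Neither is [s - a], since [s < m]. *)
  case: (b =P b') => [-> //|/eqP nb]; move: {l1 l2} dy vy nb; rewrite /moven /=.
  by case: (b); case: (b'); do 3 (case: ifP); lia.
move=> [a]; rewrite mem_iota => la ->; rewrite /between.
rewrite move_neq /=; last lia.
rewrite -(@move_move m x b a s); last lia.
by rewrite move_neq ?gdist_move ?move_move ?gdist_move //=; lia.
Qed.

(** * The differential on vertex sequences *)

Fixpoint slen (T : finType) (e : rel T) (s : seq T) : nat :=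
  if s is x :: s' then ((if s' is y :: _ then gdist e x y else 0) + slen e s')%N else 0%N.

(** The counterpart of [wbd]: it sums [D] over the length-preserving insertions of a vertex, and the
    nested minus signs produce the alternating sign. *)
Fixpoint sbd (T : finType) (e : rel T) (D : seq T -> int) (s : seq T) : int :=
  if s is x :: s' then
    if s' is y :: _ then
      - (\sum_(v | between e x v y) D (x :: v :: s')) - sbd e (fun u => D (x :: u)) s'
    else 0
  else 0.

Lemma slenE (T : finType) (e : rel T) (z : T) (s : seq T) :
  slen e s = (\sum_(i < (size s).-1) gdist e (nth z s i) (nth z s i.+1))%N.
Proof.
elim: s => [|x [|y s] IH]; rewrite ?big_ord0 //.
by rewrite [LHS]/= -/(slen e (y :: s)) IH big_ord_recl.
Qed.

Lemma tlenE (T : finType) (e : rel T) (k : nat) (x : k.+1.-tuple T) : tlen e x = slen e x.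
Proof.
rewrite (slenE e (thead x)) size_tuple; apply: eq_bigr => i _.
by rewrite !(tnth_nth (thead x)) lift0.
Qed.

Lemma inIE (T : finType) (e : rel T) (k l : nat) (x : k.+1.-tuple T) :
  inI e l x = sorted (fun a b => a != b) x && (slen e x == l).
Proof.
rewrite /inI tlenE; congr (_ && _); apply/forallP/(sortedP (thead x)) => H i.
  rewrite size_tuple ltnS => lt; have := H (Ordinal lt).
  by rewrite !(tnth_nth (thead x)) lift0.
rewrite !(tnth_nth (thead x)) lift0; apply: H.
by rewrite size_tuple ltnS /=; case: i.
Qed.

Lemma slen_cat (T : finType) (e : rel T) (p q : seq T) (a : T) :
  slen e (p ++ a :: q) = (slen e (rcons p a) + slen e (a :: q))%N.
Proof.
elim: p => [|x p IH]; first by rewrite /= add0n.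
rewrite cat_cons rcons_cons [LHS]/= [slen e (x :: rcons p a)]/= IH.
by rewrite addnA; case: p {IH}.
Qed.

Lemma val_del (T : finType) (k : nat) (x : k.+2.-tuple T) (i : 'I_k.+2) :
  del x i = take i x ++ drop i.+1 x :> seq T.
Proof.
have z := thead x; have lti := ltn_ord i.
apply: (@eq_from_nth _ z) => [|j]; rewrite size_tuple.
  by rewrite size_cat size_takel ?size_drop size_tuple; lia.
move=> ltj; rewrite -(tnth_nth z _ (Ordinal ltj)) tnth_mktuple (tnth_nth z) /=.
rewrite nth_cat size_takel ?size_tuple; last lia.
rewrite /bump; case: ltnP => h; first by rewrite nth_take.
by rewrite nth_drop; congr nth; lia.
Qed.

Lemma size_insert (T : Type) (k i : nat) (y : k.+1.-tuple T) (v : T) :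
  size (take i y ++ v :: drop i y) == k.+2.
Proof. by rewrite size_cat /= addnS -size_cat cat_take_drop size_tuple. Qed.

(** Sequences allow recursion on the length, which tuples obstruct; those of the wrong size get
    0. *)
Definition extend (T : finType) (k : nat) (c : {ffun k.+1.-tuple T -> int}) (s : seq T) : int :=
  oapp c 0 (insub s).

Lemma extend_val (T : finType) (k : nat) (c : {ffun k.+1.-tuple T -> int}) (x : k.+1.-tuple T) :
  extend c x = c x.
Proof. by rewrite /extend valK. Qed.

Lemma insert_between (T : finType) (e : rel T) (l : nat) (p q : seq T) (a v b : T) :
  let y := p ++ [:: a, b & q] in let x := p ++ [:: a, v, b & q] in
  sorted (fun a b => a != b) y -> slen e y = l ->
  [&& sorted (fun a b => a != b) x, slen e x == l & slen e y == slen e x] =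
  between e a v b.
Proof.
rewrite /= !slen_cat !sorted_cat_cons /between /= => /and3P[-> _ ->] <- /=.
case: (a != v) => //=; case: (v != b) => //=.
by apply/andP/eqP => [[/eqP h _]|h]; [lia | split; apply/eqP; lia].
Qed.

Lemma insert_split (T : Type) (z : T) (y : seq T) (i : nat) : (0 < i < size y)%N ->
  y = take i.-1 y ++ [:: nth z y i.-1, nth z y i & drop i.+1 y] /\
  (forall v, take i y ++ v :: drop i y =
             take i.-1 y ++ [:: nth z y i.-1, v, nth z y i & drop i.+1 y]).
Proof.
move=> /andP[i0 l2]; have l1 : (i.-1 < size y)%N by rewrite prednK // ltnW.
split=> [|v]; rewrite -(drop_nth z l2).
  by rewrite -{3}(prednK i0) -(drop_nth z l1) cat_take_drop.
by rewrite -[RHS]cat_rcons -(take_nth z l1) prednK.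
Qed.

Lemma insert_inI (T : finType) (e : rel T) (k l i : nat) (y : k.+1.-tuple T) (v z : T) :
  (0 < i < k.+1)%N -> inI e l y ->
  inI e l (Tuple (size_insert i y v)) && (slen e y == slen e (take i y ++ v :: drop i y)) =
  between e (nth z y i.-1) v (nth z y i).
Proof.
move=> ik; rewrite !inIE [tval (Tuple _)]/= => /andP[sy /eqP ly].
have iy : (0 < i < size y)%N by rewrite size_tuple.
have [ey ei] := insert_split z iy.
rewrite ey in sy ly; have := insert_between v sy ly.
by rewrite /= -ey -ei andbA.
Qed.

Lemma del_insert (T : finType) (k : nat) (i : 'I_k.+2) (y : k.+1.-tuple T) (v : T) :
  (i < k.+1)%N -> del (Tuple (size_insert i y v)) i = y.
Proof.
move=> ik; apply: val_inj;
rewrite /= val_del /= take_size_cat ?size_takel ?size_tuple ?(ltnW ik) //.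
rewrite -cat_rcons drop_size_cat ?cat_take_drop //.
by rewrite size_rcons size_takel ?size_tuple ?(ltnW ik).
Qed.

Lemma insert_del (T : finType) (k : nat) (i : 'I_k.+2) (x : k.+2.-tuple T) :
  (i < k.+1)%N -> Tuple (size_insert i (del x i) (tnth x i)) = x.
Proof.
move=> ik; apply: val_inj => /=; rewrite val_del.
have st : size (take i x) = i by rewrite size_takel // size_tuple ltnW.
rewrite take_size_cat // drop_size_cat // (tnth_nth (thead x)) -drop_nth ?cat_take_drop //.
by rewrite size_tuple.
Qed.

Lemma sbd_cons2 (T : finType) (e : rel T) (D : seq T -> int) (x y : T) (s : seq T) :
  sbd e D [:: x, y & s] =
  - (\sum_(v | between e x v y) D [:: x, v, y & s]) - sbd e (fun u => D (x :: u)) (y :: s).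
Proof. by []. Qed.

Lemma sbdE (T : finType) (e : rel T) (D : seq T -> int) (z : T) (y : seq T) :
  sbd e D y = \sum_(i < (size y).-1) (-1) ^+ i.+1 *
    \sum_(v | between e (nth z y i) v (nth z y i.+1)) D (take i.+1 y ++ v :: drop i.+1 y).
Proof.
elim: y D => [|x [|t y] IH] D; rewrite ?big_ord0 //.
rewrite sbd_cons2 IH [size _]/= [_.-1]/= big_ord_recl /=.
rewrite expr1 mulN1r; congr (_ + _).
rewrite -sumrN; apply: eq_bigr => i _.
by rewrite [in RHS]exprS mulN1r mulNr.
Qed.

(** For a fixed position, the tuples that delete to [y] are the insertions of one vertex into [y].
    The two end positions contribute nothing. *)
Lemma bd_sbd (T : finType) (e : rel T) (k l : nat) (b : {ffun k.+2.-tuple T -> int})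
  (y : k.+1.-tuple T) : inI e l y -> bd e l b y = sbd e (extend b) y.
Proof.
move=> Iy; rewrite ffunE (exchange_big_dep
  (fun i : 'I_k.+2 => (0 < (i : nat))%N && ((i : nat) < k.+1)%N)) /=; last first.
  by move=> x i _ /and4P[-> ->].
pose z := thead y.
rewrite (sbdE e (extend b) z) size_tuple /= big_mkcond big_ord_recl /= add0r.
rewrite big_ord_recr /= ltnn addr0; apply: eq_bigr => i _.
have lti : (i.+1 < k.+1)%N by rewrite ltnS.
rewrite /= /bump /= add1n lti -mulr_sumr; congr (_ * _).
set j := lift ord0 _.
have ltj : (j < k.+1)%N by [].
rewrite (reindex_onto (fun v => Tuple (size_insert j y v)) (fun x => tnth x j)); last first.
  by move=> x /and4P[_ _ /eqP <- _]; apply: insert_del.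
apply: eq_big => [v|v _]; last by rewrite -extend_val.
have -> : tnth (Tuple (size_insert j y v)) j == v.
  rewrite (tnth_nth z) /= nth_cat size_takel ?size_tuple ?(ltnW ltj) //.
  by rewrite ltnn subnn.
by rewrite del_insert // !tlenE eqxx /= andbT -(@insert_inI _ e k l j y v z).
Qed.

(** * Critical words are cycles *)

Lemma wbd_delta_cons (s t : bool * nat) (c w : word) :
  wbd (fun u => (s :: u == t :: c)%:R) w = if s == t then wbd (fun u => (u == c)%:R) w else 0.
Proof.
case: eqVneq => [->|ne]; first by apply: eq_wbd => u; rewrite eqseq_cons eqxx.
by rewrite -[RHS](wbd0 w); apply: eq_wbd => u; rewrite eqseq_cons (negbTE ne).
Qed.

Lemma wbd_delta_nil (s : bool * nat) (w : word) :
  wbd (fun u => (s :: u == [::])%:R) w = 0.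
Proof. exact: wbd0. Qed.

(** No two adjacent letters of a critical word merge into a valid letter: neighbours of equal sign
    include one of magnitude [m], and the sum exceeds [m]. *)
Lemma wbd_delta (m : nat) (c w : word) : critical m c -> valid m w ->
  wbd (fun u => (u == c)%:R) w = 0.
Proof.
have sp b n C w' : (forall a, (a < n)%N -> C [:: (b, a), (b, n.-1 - a)%N & w'] = 0) ->
    splits b n C w' = 0.
  by move=> H; rewrite /splits big1 => // i _; apply: H; apply: ltn_ord.
elim/word_ind: c w => [|[b0 a0]|[b0 a0] [b1 a1] c IH1 IH2] [|[b s] w] //.
- by move=> _ _; rewrite wbd_cons wbd_delta_nil sp ?subr0 ?oppr0.
- move=> _ _; rewrite wbd_cons wbd_delta_cons sp => [|a _]; last first.
    by rewrite eqseq_cons andbF.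
  case: ifP => _; rewrite ?subr0 ?oppr0 //.
  by case: w => [|t w]; rewrite ?wbd_cons ?wbd_delta_nil ?sp // !(subr0, oppr0).
rewrite critical_cons2 -![(b0, a0).1]/b0 -![(b0, a0).2]/a0 -![(b1, a1).1]/b1 -![(b1, a1).2]/a1.
move=> /andP[/eqP -> {a0}] + /andP[lts vw]; rewrite /= in lts; case: (b0 =P b1) => [<-|/eqP ne].
  move=> /andP[/eqP -> crc]; rewrite wbd_cons wbd_delta_cons sp => [|a lta]; last first.
    rewrite !eqseq_cons !xpair_eqE; case: eqP => //= _; case: eqP => //= a0.
    by case: eqP => //= e; move: lta e; rewrite a0 /=; move: lts; clear; lia.
  case: ifP => _; rewrite ?subr0 ?oppr0 // sub0r.
  case: w vw => [|[b' t] w]; first by rewrite oppr0.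
  move=> /andP[ltt vw]; rewrite wbd_cons wbd_delta_cons sp => [|a lta]; last first.
    rewrite eqseq_cons xpair_eqE; case: (a =P m.-1) => [e|_]; last by rewrite andbF.
    by move: lta ltt; rewrite e /=; clear; lia.
  by case: ifP => _; rewrite ?IH1 ?subr0 ?oppr0.
move=> crc; rewrite wbd_cons wbd_delta_cons sp => [|a _]; last first.
  by rewrite !eqseq_cons !xpair_eqE; case: eqP => //= ->; rewrite (negbTE ne) andbF.
by case: ifP => _; rewrite ?IH2 ?subr0 ?oppr0.
Qed.

(** * Linear combinations, supports and integer dependence *)

Lemma extend_sum (T : finType) (k r : nat) (a : 'I_r -> int)
  (v : 'I_r -> {ffun k.+1.-tuple T -> int}) (s : seq T) :
  extend [ffun x => \sum_i a i * v i x] s = \sum_i a i * extend (v i) s.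
Proof.
rewrite /extend; case: insubP => [x _ _|_] /=; first by rewrite ffunE.
by rewrite big1 // => i _; rewrite mulr0.
Qed.

Lemma bd_sum (T : finType) (e : rel T) (k l r : nat) (a : 'I_r -> int)
  (v : 'I_r -> {ffun k.+2.-tuple T -> int}) (y : k.+1.-tuple T) :
  bd e l [ffun x => \sum_i a i * v i x] y = \sum_i a i * bd e l (v i) y.
Proof.
under [RHS]eq_bigr => i _ do rewrite ffunE mulr_sumr.
rewrite exchange_big ffunE; apply: eq_bigr => x _.
under [RHS]eq_bigr => i _ do rewrite mulr_sumr.
rewrite exchange_big; apply: eq_bigr => j _ /=; rewrite ffunE mulr_sumr.
by apply: eq_bigr => i _; rewrite mulrCA.
Qed.

Lemma is_cycle_sum (T : finType) (e : rel T) (k l r : nat) (a : 'I_r -> int)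
  (v : 'I_r -> {ffun k.+1.-tuple T -> int}) :
  (forall i, is_cycle e l (v i)) -> is_cycle e l [ffun x => \sum_i a i * v i x].
Proof.
have chain_sum : (forall i, chain e l (v i)) -> chain e l [ffun x => \sum_i a i * v i x].
  by move=> h x nx; rewrite ffunE big1 // => i _; rewrite h ?mulr0.
case: k v chain_sum => [|k] v chain_sum h; first exact: chain_sum.
split=> [|y]; first by apply: chain_sum => i; case: (h i).
by rewrite bd_sum big1 // => i _; case: (h i) => _ ->; rewrite mulr0.
Qed.

Lemma gdist_gt0 (T : finType) (e : rel T) (x y : T) : (0 < gdist e x y)%N = (x != y).
Proof.
rewrite /gdist; have : (0 < #|T|)%N by apply/card_gt0P; exists x.
by case: #|T| => // n _ /=; rewrite inE eq_sym; case: eqP.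
Qed.

(** Distinct vertices have positive distance, so an unchanged length forces [a] and [b] to
    differ. *)
Lemma sorted_delete (T : finType) (e : rel T) (p q : seq T) (a v b : T) :
  sorted (fun a b => a != b) (p ++ [:: a, v, b & q]) ->
  slen e (p ++ [:: a, b & q]) = slen e (p ++ [:: a, v, b & q]) ->
  sorted (fun a b => a != b) (p ++ [:: a, b & q]).
Proof.
rewrite !slen_cat !sorted_cat_cons /= => /and4P[-> av _ ->] h.
by rewrite andbT /= -(gdist_gt0 e); rewrite -(gdist_gt0 e) in av; lia.
Qed.

Lemma inI_del (T : finType) (e : rel T) (k l : nat) (x : k.+2.-tuple T) (i : 'I_k.+2) :
  (0 < i < k.+1)%N -> tlen e (del x i) == tlen e x -> inI e l x -> inI e l (del x i).
Proof.
move=> ik; rewrite -{2 3}(@insert_del _ _ i x) ?(andP ik).2 // !inIE !tlenE /=.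
have iy : (0 < i < size (del x i))%N by rewrite size_tuple.
have [ey ei] := insert_split (thead (del x i)) iy.
rewrite ei => /eqP ed /andP[sx lx]; rewrite ed lx andbT ey.
apply: (sorted_delete sx (e := e)); exact: etrans (congr1 (slen e) (esym ey)) ed.
Qed.

Lemma int_dependent (r : nat) (M : 'I_r.+1 -> 'I_r -> int) :
  exists2 a : 'I_r.+1 -> int, (exists i, a i != 0) & forall j, \sum_i a i * M i j = 0.
Proof.
pose A : 'M[rat]_(r.+1, r) := \matrix_(i, j) (M i j)%:~R.
pose u := nz_row (kermx A).
have uA : u *m A = 0 by apply/sub_kermxP; exact: nz_row_sub.
have u0 : u != 0.
  rewrite nz_row_eq0 -mxrank_eq0 mxrank_ker; have := rank_leq_col A; lia.
(* A polynomial with the entries of [u] as coefficients has all their denominators cleared at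
   once. *)
have [q [d d0 e]] := rat_poly_scale (\poly_(i < r.+1) u 0 (inord i)).
have uE (i : 'I_r.+1) : u 0 i = d%:~R^-1 * (q`_i)%:~R.
  have := congr1 (fun p : {poly rat} => p`_i) e.
  by rewrite coef_poly ltn_ord inord_val coefZ coef_map.
exists (fun i => q`_i) => [|j].
  have /rV0Pn [i ui] : u != 0 by [].
  by exists i; apply: contra ui => /eqP qi; rewrite uE qi mulr0.
have /matrixP/(_ 0 j) := uA; rewrite !mxE => s0.
apply/eqP; rewrite -(intr_eq0 rat) rmorph_sum /=.
have : d%:~R^-1 * (\sum_(i < r.+1) (q`_i * M i j)%:~R) = 0 :> rat.
  rewrite mulr_sumr -[RHS]s0; apply: eq_bigr => /= i _.
  by rewrite uE mxE rmorphM /= mulrA.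
by move/eqP; rewrite mulf_eq0 invr_eq0 intr_eq0 (negbTE d0).
Qed.

(** * Vertex sequences as walks along words *)

Fixpoint walk (m : nat) (x : 'I_(2 * m + 1)) (w : word) : seq 'I_(2 * m + 1) :=
  x :: (if w is s :: w' then walk (move x s) w' else [::]).

Fixpoint steps (m : nat) (x : 'I_(2 * m + 1)) (s : seq 'I_(2 * m + 1)) : word :=
  if s is y :: s' then step x y :: steps y s' else [::].

Lemma walkE (m : nat) (x : 'I_(2 * m + 1)) (w : word) : walk x w = x :: behead (walk x w).
Proof. by case: w. Qed.

Lemma size_walk (m : nat) (x : 'I_(2 * m + 1)) (w : word) : size (walk x w) = (size w).+1.
Proof. by elim: w x => //= s w IH x; rewrite IH. Qed.

Lemma steps_walk (m : nat) (x : 'I_(2 * m + 1)) (w : word) :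
  valid m w -> steps x (behead (walk x w)) = w.
Proof.
elim: w x => //= s w IH x /andP[lt vw].
by rewrite walkE /= step_move // IH.
Qed.

Lemma walk_inj (m : nat) (x x' : 'I_(2 * m + 1)) (w w' : word) :
  valid m w -> valid m w' -> (walk x w == walk x' w') = (x == x') && (w == w').
Proof.
move=> vw vw'; apply/eqP/andP => [e|[/eqP -> /eqP -> //]].
have ex : x = x' by move: e; rewrite walkE (walkE x') => -[].
by rewrite -(steps_walk x vw) e -ex steps_walk.
Qed.

Lemma sorted_walk (m : nat) (x : 'I_(2 * m + 1)) (w : word) :
  valid m w -> sorted (fun a b => a != b) (walk x w).
Proof.
elim: w x => //= s w IH x /andP[lt vw].
by have := IH (move x s) vw; rewrite walkE /= => ->; rewrite move_neq.
Qed.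

Lemma slen_walk (m : nat) (x : 'I_(2 * m + 1)) (w : word) :
  valid m w -> slen (cycle_adj (2 * m + 1)) (walk x w) = weight w.
Proof.
elim: w x => //= s w IH x /andP[lt vw].
by rewrite IH // walkE gdist_move // weight_cons.
Qed.

Lemma walk_steps (m : nat) (x : 'I_(2 * m + 1)) (s : seq 'I_(2 * m + 1)) :
  path (fun a b => a != b) x s -> valid m (steps x s) /\ walk x (steps x s) = x :: s.
Proof.
elim: s x => //= y s IH x /andP[xy ps].
by have [lt ->] := move_step xy; have [-> ->] := IH y ps; rewrite lt.
Qed.

Lemma sbd_walk (m : nat) (D : seq 'I_(2 * m + 1) -> int) (x : 'I_(2 * m + 1)) (w : word) :
  valid m w -> sbd (cycle_adj (2 * m + 1)) D (walk x w) = wbd (fun u => D (walk x u)) w.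
Proof.
elim: w x D => // s w IH x D /andP[lt vw].
rewrite wbd_cons [walk x _]/= walkE sbd_cons2 -walkE IH // sum_between //.
congr (- _ - _); apply: eq_bigr => a _; have lta := ltn_ord a.
by rewrite /= move_move -?surjective_pairing ?lta // walkE.
Qed.

Lemma bd_notin (T : finType) (e : rel T) (k l : nat) (b : {ffun k.+2.-tuple T -> int})
  (y : k.+1.-tuple T) : ~~ inI e l y -> bd e l b y = 0.
Proof.
move=> ny; rewrite ffunE big1 // => x Ix; rewrite big1 // => i /and4P[i0 ik /eqP ey tl].
by case/negP: ny; rewrite -ey inI_del // i0.
Qed.

(** The component of [c] in the copy of the word complex that belongs to the starting vertex [x]. *)
Definition word_chain (m k : nat) (c : {ffun k.+1.-tuple 'I_(2 * m + 1) -> int})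
  (x : 'I_(2 * m + 1)) (w : word) : int := extend c (walk x w).

Lemma inI_walk (m k l : nat) (y : k.+1.-tuple 'I_(2 * m + 1)) (x : 'I_(2 * m + 1)) (w : word) :
  valid m w -> y = walk x w :> seq _ -> inI (cycle_adj (2 * m + 1)) l y = (weight w == l).
Proof. by move=> vw ey; rewrite inIE ey sorted_walk ?slen_walk. Qed.

Lemma inI_walkP (m k l : nat) (y : k.+1.-tuple 'I_(2 * m + 1)) :
  inI (cycle_adj (2 * m + 1)) l y ->
  exists x w, [/\ valid m w, size w = k, weight w = l & y = walk x w :> seq _].
Proof.
case: y => -[|x s] // sz; rewrite inIE /= => /andP[ps /eqP sl].
have [vw ew] := walk_steps ps; exists x, (steps x s); split=> //.
  by apply: succn_inj; rewrite -(size_walk x) ew (eqP sz).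
by rewrite -(slen_walk x vw) ew -sl.
Qed.

Lemma walk_tuple (m k : nat) (x : 'I_(2 * m + 1)) (w : word) : size w = k ->
  exists y : k.+1.-tuple 'I_(2 * m + 1), y = walk x w :> seq _.
Proof.
move=> sw; have sz : size (walk x w) == k.+1 by rewrite size_walk sw.
by exists (Tuple sz).
Qed.

Lemma word_chainE (m k : nat) (c : {ffun k.+1.-tuple 'I_(2 * m + 1) -> int})
  (x : 'I_(2 * m + 1)) (w : word) (y : k.+1.-tuple 'I_(2 * m + 1)) :
  y = walk x w :> seq _ -> word_chain c x w = c y.
Proof. by move=> ey; rewrite /word_chain -ey extend_val. Qed.

Lemma bd_walk (m k l : nat) (b : {ffun k.+2.-tuple 'I_(2 * m + 1) -> int})
  (y : k.+1.-tuple 'I_(2 * m + 1)) (x : 'I_(2 * m + 1)) (w : word) :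
  valid m w -> weight w = l -> y = walk x w :> seq _ ->
  bd (cycle_adj (2 * m + 1)) l b y = wbd (word_chain b x) w.
Proof.
move=> vw ww ey; rewrite bd_sbd ?(inI_walk l vw ey) ?ww // ey sbd_walk //.
Qed.

Lemma wbd_cycle (m k l : nat) (c : {ffun k.+1.-tuple 'I_(2 * m + 1) -> int})
  (x : 'I_(2 * m + 1)) (w : word) :
  is_cycle (cycle_adj (2 * m + 1)) l c -> valid m w -> (size w).+1 = k ->
  wbd (word_chain c x) w = 0.
Proof.
case: k c => // k c [chc bdc] vw [sw]; have [y ey] := walk_tuple x sw.
have [ww|nw] := eqVneq (weight w) l; first by rewrite -(bd_walk c vw ww ey) bdc.
rewrite -[RHS](wbd0 w); apply: (@wbd_local m) => u su wu vu _.
have [z ez] : exists z : k.+2.-tuple 'I_(2 * m + 1), z = walk x u :> seq _.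
  by apply: walk_tuple; rewrite su sw.
by rewrite (word_chainE c ez) chc // (inI_walk l (vu vw) ez) wu.
Qed.

Lemma phi_bdry (m k l : nat) (c : {ffun k.+1.-tuple 'I_(2 * m + 1) -> int})
  (x : 'I_(2 * m + 1)) (d : word) : (0 < m)%N ->
  is_bdry (cycle_adj (2 * m + 1)) l c -> d \in crits m k l -> phi m d (word_chain c x) = 0.
Proof.
move=> m0 [b [_ bdb]]; rewrite mem_crits // => /and3P[crd /eqP sd /eqP wd].
rewrite -(phi_wbd m (word_chain b x) d); apply: phi_local => // u su wu vu _.
have [y ey] : exists y : k.+1.-tuple 'I_(2 * m + 1), y = walk x u :> seq _.
  by apply: walk_tuple; rewrite su.
by rewrite (word_chainE c ey) -bdb (bd_walk b vu _ ey) // wu.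
Qed.

(** Deleting interior vertices fixes the start, so [wbd_exact] applies to each starting vertex
    separately and the primitives are glued. *)
Lemma bdry_of_phi (m k l : nat) (c : {ffun k.+1.-tuple 'I_(2 * m + 1) -> int}) : (0 < m)%N ->
  is_cycle (cycle_adj (2 * m + 1)) l c ->
  (forall x d, d \in crits m k l -> phi m d (word_chain c x) = 0) ->
  is_bdry (cycle_adj (2 * m + 1)) l c.
Proof.
move=> m0 cyc phc.
have chc : chain (cycle_adj (2 * m + 1)) l c by case: k c cyc {phc} => [|k] c // [].
have /fin_all_exists [B BP] : forall x, exists B, forall w, valid m w -> size w = k ->
    wbd B w = word_chain c x w.
  move=> x; apply: wbd_exact => // [w vw sw|d crd sd]; first exact: wbd_cycle cyc vw sw.
  have [wd|nw] := eqVneq (weight d) l.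
    by apply: phc; rewrite mem_crits // crd sd wd !eqxx.
  rewrite -(phi0 m d); apply: phi_local => // u su wu vu _.
  have [y ey] : exists y : k.+1.-tuple 'I_(2 * m + 1), y = walk x u :> seq _.
    by apply: walk_tuple; rewrite su.
  by rewrite (word_chainE c ey) chc // (inI_walk l vu ey) wu.
(* The primitives may be nonzero in other weights, so they are cut down to length [l]. *)
pose b : {ffun k.+2.-tuple 'I_(2 * m + 1) -> int} :=
  [ffun t => if inI (cycle_adj (2 * m + 1)) l t
   then B (thead t) (steps (thead t) (behead t)) else 0].
exists b; split=> [t nt|y]; first by rewrite ffunE (negbTE nt).
have [Iy|nIy] := boolP (inI (cycle_adj (2 * m + 1)) l y); last by rewrite bd_notin ?chc.
have [x [w [vw sw ww ey]]] := inI_walkP Iy.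
rewrite (bd_walk b vw ww ey) -(word_chainE c ey) -BP //.
apply: (@wbd_local m) => u su wu vu _.
have [t et] : exists t : k.+2.-tuple 'I_(2 * m + 1), t = walk x u :> seq _.
  by apply: walk_tuple; rewrite su sw.
rewrite (word_chainE b et) ffunE (inI_walk l (vu vw) et) wu ww eqxx.
have -> : thead t = x by rewrite /thead (tnth_nth x) et walkE.
by rewrite et steps_walk ?vu.
Qed.

(** * Dual families of cycles and cocycles *)

Definition walk_delta (m k : nat) (x : 'I_(2 * m + 1)) (d : word) :
  {ffun k.+1.-tuple 'I_(2 * m + 1) -> int} := [ffun y : k.+1.-tuple _ => (val y == walk x d)%:R].

Lemma word_chain_delta (m k : nat) (x x' : 'I_(2 * m + 1)) (d w : word) :
  valid m d -> valid m w -> size w = k ->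
  word_chain (walk_delta k x d) x' w = (x' == x)%:R * (w == d)%:R.
Proof.
move=> vd vw sw; have [y ey] := walk_tuple x' sw.
by rewrite (word_chainE _ ey) ffunE /= ey walk_inj // -natrM mulnb.
Qed.

Lemma critical_valid (m : nat) (d : word) : (0 < m)%N -> critical m d -> valid m d.
Proof.
move=> m0; elim/word_ind: d => [|[b a]|[b a] [b' a'] d IH1 IH2] //.
  by rewrite /= !andbT => /eqP ->.
rewrite critical_cons2 => /andP[/= /eqP ->]; rewrite m0.
by case: ifP => _ => [/andP[/eqP -> /IH1 ->]|/IH2 //]; rewrite andbT ltn_predL.
Qed.

Lemma is_cycle_delta (m k l : nat) (x : 'I_(2 * m + 1)) (d : word) : (0 < m)%N ->
  d \in crits m k l -> is_cycle (cycle_adj (2 * m + 1)) l (walk_delta k x d).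
Proof.
move=> m0; rewrite mem_crits // => /and3P[crd /eqP sd /eqP wd].
have vd := critical_valid m0 crd.
have ch : chain (cycle_adj (2 * m + 1)) l (walk_delta k x d).
  move=> y ny; rewrite ffunE; case: eqP => // ey; case/negP: ny.
  by rewrite (inI_walk l vd ey) wd.
case: k sd ch => [|k] sd ch //; split=> // y.
have [Iy|nIy] := boolP (inI (cycle_adj (2 * m + 1)) l y); last exact: bd_notin.
have [x' [w [vw sw ww ey]]] := inI_walkP Iy.
rewrite (bd_walk _ vw ww ey).
(* The scalar multiple is written as a one-term sum to apply [wbd_sum]. *)
transitivity (wbd (fun u => \sum_(i < 1) (x' == x)%:R * (u == d)%:R) w).
  apply: (@wbd_local m) => u su wu vu _.
  by rewrite big_ord1 word_chain_delta ?vu // su sw.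
by rewrite (wbd_sum (fun=> (x' == x)%:R) (fun _ u => (u == d)%:R)) big_ord1 (wbd_delta crd) ?mulr0.
Qed.

Lemma phi_word_chain_delta (m k l : nat) (x x' : 'I_(2 * m + 1)) (d d' : word) : (0 < m)%N ->
  d \in crits m k l -> d' \in crits m k l ->
  phi m d' (word_chain (walk_delta k x d) x') = ((x, d) == (x', d'))%:R.
Proof.
move=> m0; rewrite !mem_crits // => /and3P[crd _ _] /and3P[crd' /eqP sd' _].
transitivity (phi m d' (fun u => \sum_(i < 1) (x' == x)%:R * (u == d)%:R)).
  apply: phi_local => // u su _ vu _.
  by rewrite big_ord1 word_chain_delta ?(critical_valid m0 crd) // su.
rewrite (phi_sum m (fun=> (x' == x)%:R) (fun _ u => (u == d)%:R)) big_ord1 phi_delta //.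
by rewrite xpair_eqE -natrM mulnb eq_sym [d' == d]eq_sym.
Qed.

Lemma phi_word_chain_sum (m k r : nat) (a : 'I_r -> int)
  (v : 'I_r -> {ffun k.+1.-tuple 'I_(2 * m + 1) -> int}) (x : 'I_(2 * m + 1)) (d : word) :
  phi m d (word_chain [ffun y => \sum_i a i * v i y] x) =
  \sum_i a i * phi m d (word_chain (v i) x).
Proof. by rewrite -phi_sum; apply: eq_phi => u; rewrite /word_chain extend_sum. Qed.

Theorem theorem3p5 (m : nat) (hm : (2 <= m)%N) (T : int -> int -> int)
  (HTneg : forall k l : int, (k < 0) || (l < 0) -> T k l = 0)
  (HT00 : T 0 0 = (2 * m + 1)%N%:Z)
  (HT11 : T 1 1 = (4 * m + 2)%N%:Z)
  (HTrec : forall k l : int, 0 <= k -> 0 <= l -> (k, l) != (0, 0) -> (k, l) != (1, 1) ->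
     T k l = T (k - 1) (l - 1) + 2 * T (k - 2) (l - (m.+1)%:Z)) :
  (forall k l : nat, MH_torsion_free (cycle_adj (2 * m + 1)%N) k l) /\
  (forall k l : nat, exists r : nat,
      T k%:Z l%:Z = r%:Z /\ MH_rank (cycle_adj (2 * m + 1)%N) k l r).
Proof.
have m0 : (0 < m)%N by exact: ltnW.
split=> [k l c cyc d d0 bdc|k l].
  (* The pairings are integers and detect boundaries, so the factor [d] cancels. *)
  apply: bdry_of_phi => // x w crw; have := phi_bdry x m0 bdc crw.
  have -> : [ffun y => d * c y] = [ffun y => \sum_(i < 1) d * c y].
    by apply/ffunP => y; rewrite !ffunE big_ord1.
  rewrite (phi_word_chain_sum (fun=> d) (fun=> c)) big_ord1 => /eqP.
  by rewrite mulf_eq0 (negbTE d0) => /eqP.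
pose E := [seq (x, w) | x <- enum 'I_(2 * m + 1), w <- crits m k l].
have uE : uniq E.
  apply: allpairs_uniq; rewrite ?enum_uniq ?uniq_crits //.
  by move=> [x w] [x' w'] _ _ [-> ->].
pose p (i : 'I_(size E)) := tnth (in_tuple E) i.
have pE i : (p i).2 \in crits m k l.
  by have := mem_tnth i (in_tuple E); rewrite -/(p i) => /allpairsP[[x w] [_ h ->]].
have pinj i j : (p i == p j) = (i == j).
  by apply/eqP/eqP => [/(tuple_uniqP (in_tuple E) uE)|->].
exists (size E); split.
  by rewrite (rank_recursion HTneg HT00 HT11 HTrec) size_allpairs size_enum_ord.
split=> [|v cyv indv].
  exists (fun i => walk_delta k (p i).1 (p i).2); split=> [i|a bda j].
    exact: is_cycle_delta.
  have := phi_bdry (p j).1 m0 bda (pE j).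
  rewrite (phi_word_chain_sum a (fun i => walk_delta k (p i).1 (p i).2)).
  rewrite (bigD1 j) //= big1 => [|i ij]; rewrite (phi_word_chain_delta _ _ m0 (pE _) (pE _)).
    by rewrite -!surjective_pairing eqxx mulr1 addr0.
  by rewrite -!surjective_pairing pinj (negbTE ij) mulr0.
(* There is one more cycle than there are pairings, so some nontrivial combination has all pairings
   zero and is a boundary. *)
have [a [i ai] aM] := int_dependent (fun i j => phi m (p j).2 (word_chain (v i) (p j).1)).
have a0 : forall i, a i = 0.
  apply: indv; apply: bdry_of_phi => // [|x d crd]; first exact: is_cycle_sum.
  have /tnthP[j ej] : (x, d) \in in_tuple E by apply/allpairsP; exists (x, d); rewrite mem_enum.
  by rewrite phi_word_chain_sum -[RHS](aM j) /p -ej.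
by rewrite a0 eqxx in ai.
Qed.
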